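(* Let $n\ge 2$, let $(x_1,y_1),\dots,(x_n,y_n)\in\mathbb{R}^d\times\mathbb{R}$ be data points, let $h_1,h_2>0$ be bandwidths, let $v(i,j)=K_{h_1}(y_i-y_j)\,K_{h_2}(\|x_i-x_j\|)$ and $A_i=\sum_{j\neq i}v(i,j)$, assume $A_i>0$ for all $i$, and let $$L=\frac1n\sum_{i=1}^n\log(A_i)-\log(n-1).$$ Let $\epsilon>0$. Consider any dual-tree evaluation of the $A_i$ (as defined in the context) in which, for a node pair $(q,r)$, the contribution $S_r(i)=\sum_{j\in r,\,j\ne i}v(i,j)$ of $r$ to $A_i$ is replaced, for every $i\in q$, by $\hat S_r=(n_r-1)\,\frac{v_r^{\max}+v_r^{\min}}{2}$ only when $n_r\ge 2$, $v_r^{\min}>0$ and $$\frac{(n_r+1)\,v_r^{\max}}{(n_r-1)\,v_r^{\min}}\le 2e^{\epsilon}-1,$$ where $n_r$ is the number of points in $r$ and $v_r^{\min},v_r^{\max}$ are bounds with $v_r^{\min}\le v(i,j)\le v_r^{\max}$ for all $i\in q$, $j\in r$; all other contributions are computed exactly. Let $\hat A_i$ be the resulting values and $\hat L=\frac1n\sum_{i=1}^n\log(\hat A_i)-\log(n-1)$. Then $|\hat L-L|\le\epsilon$.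
   Context: Kernels: $K$ is a kernel function, i.e. a nonnegative symmetric probability density, and $K_h(t)=\frac1{h^{m}}K(t/h)$, where $m$ is the dimension of the variable being smoothed ($m=1$ for $y$, $m=d$ for $x$). In particular $v(i,j)\ge 0$. The quantity $L=L(h_1,h_2)$ is the cross-validated log likelihood $\frac1n\sum_i\log\big(\hat f^{-i}(y_i|x_i)\hat f^{-i}(x_i)\big)$ of the Nadaraya-Watson kernel conditional density estimator, which equals the expression in the claim. Dual-tree evaluation: one has two binary trees whose nodes are nonempty subsets of the index set $\{1,\dots,n\}$, each root being $\{1,\dots,n\}$ and the two children of any non-leaf node partitioning that node. The evaluation starts from the pair of roots and processes node pairs $(q,r)$ ($q$ from the first tree, $r$ from the second) recursively. At a pair $(q,r)$: either it is pruned, meaning that for every $i\in q$ the contribution $S_r(i)=\sum_{j\in r,\,j\neq i}v(i,j)$ is replaced by a single approximation $\hat S_r$; or, if both nodes are leaves, the contributions $S_r(i)$, $i\in q$, are computed exactly; or the pair is replaced by the pairs obtained by splitting the non-leaf nodes into their children. Consequently, for each $i$, the nodes $r$ occurring in terminal (pruned or exactly computed) pairs $(q,r)$ with $i\in q$ form a partition $R^{(i)}$ of $\{1,\dots,n\}$, and $\hat A_i$ is the sum over $r\in R^{(i)}$ of the approximate or exact contributions. *)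

(* Defs.v *)
From mathcomp Require Import all_boot all_order all_algebra.
From mathcomp Require Import all_classical all_reals all_analysis.

Set Implicit Arguments.
Unset Strict Implicit.
Unset Printing Implicit Defensive.

Import Order.TTheory GRing.Theory Num.Theory.

Local Open Scope ring_scope.

Record is_kernel (R : realType) (K : R -> R) : Prop := IsKernel {
  kernel_ge0 : forall t, 0 <= K t;
  kernel_sym : forall t, K (- t) = K t;
  kernel_meas : measurable_fun [set: R]%classic K;
  kernel_int1 : (\int[@lebesgue_measure R]_t (K t)%:E = 1)%E
}.

(* [m] is the dimension of the variable being smoothed. *)
Definition scaled_kernel (R : realType) (K : R -> R) (m : nat) (h t : R) : R :=
  (h ^+ m)^-1 * K (t / h).

(* MathComp-Analysis norms ['rV_d] with the sup norm, hence this definition. *)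
Definition euclid_norm (R : realType) (d : nat) (u : 'rV[R]_d) : R :=
  Num.sqrt (\sum_(k < d) u ord0 k ^+ 2).

Definition kernel_weight (R : realType) (n d : nat) (K : R -> R) (h1 h2 : R)
    (x : 'I_n -> 'rV[R]_d) (y : 'I_n -> R) (i j : 'I_n) : R :=
  scaled_kernel K 1 h1 (y i - y j)
  * scaled_kernel K d h2 (euclid_norm (x i - x j)).

(* The contribution S_r(i) of the point set [r] to A_i. *)
Definition contribution (R : realType) (n : nat) (v : 'I_n -> 'I_n -> R)
    (r : {set 'I_n}) (i : 'I_n) : R :=
  \sum_(j in r | j != i) v i j.

Definition loo_sum (R : realType) (n : nat) (v : 'I_n -> 'I_n -> R)
    (i : 'I_n) : R :=
  \sum_(j | j != i) v i j.

Definition cv_loglik (R : realType) (n : nat) (A : 'I_n -> R) : R :=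
  n%:R^-1 * (\sum_i ln (A i)) - ln (n%:R - 1).

Inductive bintree (n : nat) : Type :=
| Leaf of {set 'I_n}
| Node of {set 'I_n} & bintree n & bintree n.

Definition points (n : nat) (t : bintree n) : {set 'I_n} :=
  match t with Leaf s => s | Node s _ _ => s end.

Fixpoint partitioning (n : nat) (t : bintree n) : bool :=
  match t with
  | Leaf s => s != finset.set0
  | Node s t1 t2 =>
      [&& s != finset.set0, points t1 :|: points t2 == s,
          [disjoint points t1 & points t2], partitioning t1 & partitioning t2]
  end.

Definition index_tree (n : nat) (t : bintree n) : Prop :=
  partitioning t /\ points t = [set: 'I_n].

(* A terminal pair (q, r): [Some s] means that it is pruned, with the single
   approximation [s] used for every point of q; [None] means that it is computed
   exactly. *)
Definition terminal (R : realType) (n : nat) : Type :=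
  ({set 'I_n} * {set 'I_n} * option R)%type.

(* [dual_tree_eval tq tr ts]: some run of the recursion started at the pair
   (tq, tr) has [ts] as its list of terminal pairs. *)
Inductive dual_tree_eval (R : realType) (n : nat) :
    bintree n -> bintree n -> seq (terminal R n) -> Prop :=
| eval_prune tq tr (s : R) :
    dual_tree_eval tq tr [:: (points tq, points tr, Some s)]
| eval_exact q r :
    dual_tree_eval (Leaf q) (Leaf r) [:: (q, r, None)]
| eval_split_q q q1 q2 r ts1 ts2 :
    dual_tree_eval q1 (Leaf r) ts1 ->
    dual_tree_eval q2 (Leaf r) ts2 ->
    dual_tree_eval (Node q q1 q2) (Leaf r) (ts1 ++ ts2)
| eval_split_r q r r1 r2 ts1 ts2 :
    dual_tree_eval (Leaf q) r1 ts1 ->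
    dual_tree_eval (Leaf q) r2 ts2 ->
    dual_tree_eval (Leaf q) (Node r r1 r2) (ts1 ++ ts2)
| eval_split_qr q q1 q2 r r1 r2 ts11 ts12 ts21 ts22 :
    dual_tree_eval q1 r1 ts11 ->
    dual_tree_eval q1 r2 ts12 ->
    dual_tree_eval q2 r1 ts21 ->
    dual_tree_eval q2 r2 ts22 ->
    dual_tree_eval (Node q q1 q2) (Node r r1 r2) (ts11 ++ ts12 ++ ts21 ++ ts22).

Definition terminal_value (R : realType) (n : nat) (v : 'I_n -> 'I_n -> R)
    (t : terminal R n) (i : 'I_n) : R :=
  if t.2 is Some s then s else contribution v t.1.2 i.

Definition approx_sum (R : realType) (n : nat) (v : 'I_n -> 'I_n -> R)
    (ts : seq (terminal R n)) (i : 'I_n) : R :=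
  \sum_(t <- ts | i \in t.1.1) terminal_value v t i.

(* The bounds [vmin] and [vmax] need not be tight, and may depend on both
   q and r. *)
Definition admissible_prune (R : realType) (n : nat) (v : 'I_n -> 'I_n -> R)
    (eps : R) (q r : {set 'I_n}) (s : R) : Prop :=
  exists vmin vmax : R,
    [/\ forall i j, i \in q -> j \in r -> vmin <= v i j <= vmax,
        (2 <= #|r|)%N,
        0 < vmin,
        (#|r|%:R + 1) * vmax / ((#|r|%:R - 1) * vmin) <= 2 * expR eps - 1
      & s = (#|r|%:R - 1) * ((vmax + vmin) / 2)].

(* Main.v *)
(** Each pruned contribution is within a factor [e^eps] of the exact one, on
    both sides. With [m = n_r], [a = vmin], [b = vmax], the exact value lies in
    [[(m - 1) a, m b]], the upper end being possible because [i] need not belong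
    to [r]. The lower end asks for [(a + b) / (2 a) <= e^eps], and the upper end
    for [2 m b / ((m - 1) (a + b)) <= e^eps]; given the pruning criterion, the
    latter reduces to [0 <= (b - a) ((m + 1) b - (m - 1) a)]. As all
    contributions are nonnegative, these multiplicative bounds add up over the
    partition of the index set seen by [i], and taking logarithms and averaging
    turns them into the additive bound [eps]. *)
Require Import Defs.
From mathcomp Require Import all_boot all_order all_algebra.
From mathcomp Require Import all_classical all_reals all_analysis.
From mathcomp Require Import lra.

Import Order.TTheory GRing.Theory Num.Theory.

Local Open Scope ring_scope.

Lemma kernel_weight_ge0 (R : realType) (n d : nat) (K : R -> R) (h1 h2 : R)
    (x : 'I_n -> 'rV[R]_d) (y : 'I_n -> R) (i j : 'I_n) :
  (forall t, 0 <= K t) -> 0 <= h1 -> 0 <= h2 ->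
  0 <= kernel_weight K h1 h2 x y i j.
Proof.
by move=> K0 h10 h20; rewrite !mulr_ge0 ?invr_ge0 ?exprn_ge0.
Qed.

Lemma contributionU (R : realType) (n : nat) (v : 'I_n -> 'I_n -> R)
    (r1 r2 : {set 'I_n}) (i : 'I_n) :
  [disjoint r1 & r2] ->
  contribution v (r1 :|: r2) i = contribution v r1 i + contribution v r2 i.
Proof.
move=> dis; rewrite /contribution !big_mkcondr -bigU //=.
by apply: eq_bigl => j; rewrite !inE.
Qed.

Lemma contribution_ge0 (R : realType) (n : nat) (v : 'I_n -> 'I_n -> R)
    (r : {set 'I_n}) (i : 'I_n) :
  (forall j, 0 <= v i j) -> 0 <= contribution v r i.
Proof. by move=> v0; apply: sumr_ge0. Qed.

Lemma contribution_setT (R : realType) (n : nat) (v : 'I_n -> 'I_n -> R)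
    (i : 'I_n) :
  contribution v [set: 'I_n] i = loo_sum v i.
Proof. by apply: eq_bigl => j; rewrite inE. Qed.

(** Induction on the run: splitting [tr] splits the contribution, splitting [tq] splits the
    membership of [i]. The multiplicity, 0 or 1, lets the induction pass through query nodes that
    miss [i]. *)
Lemma dual_tree_eval_sum (R : realType) (n : nat) (v : 'I_n -> 'I_n -> R)
    (i : 'I_n) (tq tr : bintree n) (ts : seq (terminal R n)) :
  dual_tree_eval tq tr ts -> partitioning tq -> partitioning tr ->
  \sum_(t <- ts | i \in t.1.1) contribution v t.1.2 i
    = contribution v (points tr) i *+ (i \in points tq).
Proof.
have inU (A B : {set 'I_n}) : [disjoint A & B] ->
    (i \in A :|: B) = ((i \in A) + (i \in B))%N :> nat.
  move=> dis; rewrite inE; case: (boolP (i \in A)) => //= iA.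
  by rewrite (disjointFr dis iA).
elim=> {tq tr ts}.
- by move=> tq tr s _ _; rewrite big_cons big_nil /=; case: ifP; rewrite ?addr0.
- by move=> q r _ _; rewrite big_cons big_nil /=; case: ifP; rewrite ?addr0.
- move=> q q1 q2 r ts1 ts2 _ IH1 _ IH2 /and5P[_ /eqP <- dq p1 p2] pr.
  by rewrite big_cat /= IH1 // IH2 // inU // mulrnDr.
- move=> q r r1 r2 ts1 ts2 _ IH1 _ IH2 pq /and5P[_ /eqP <- dr p1 p2].
  by rewrite big_cat /= IH1 // IH2 // contributionU // mulrnDl.
- move=> q q1 q2 r r1 r2 ts11 ts12 ts21 ts22 _ IH11 _ IH12 _ IH21 _ IH22.
  move=> /and5P[_ /eqP <- dq pq1 pq2] /and5P[_ /eqP <- dr pr1 pr2].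
  rewrite !big_cat /= IH11 // IH12 // IH21 // IH22 //.
  by rewrite contributionU // inU // mulrnDr !mulrnDl !addrA.
Qed.

(** The sum has [#|r| - 1] or [#|r|] terms according to whether [i] lies in [r]; the signs of [a]
    and [b] make one pair of bounds cover both cases. *)
Lemma contribution_bounds (R : realType) (n : nat) (v : 'I_n -> 'I_n -> R)
    (r : {set 'I_n}) (i : 'I_n) (a b : R) :
  (forall j, j \in r -> a <= v i j <= b) -> 0 <= a -> 0 <= b ->
  (#|r|%:R - 1) * a <= contribution v r i <= #|r|%:R * b.
Proof.
move=> vab a0 b0.
have -> : contribution v r i = \sum_(j in r :\ i) v i j.
  by apply: eq_bigl => j; rewrite !inE andbC.
have cardr : #|r|%:R = (i \in r)%:R + #|r :\ i|%:R :> R.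
  by rewrite -natrD -cardsD1.
have i01 : 0 <= ((i \in r)%:R : R) <= 1 by rewrite ler0n lern1 leq_b1.
apply/andP; split.
  apply: (@le_trans _ _ (#|r :\ i|%:R * a)).
    by apply: ler_wpM2r => //; lra.
  rewrite mulr_natl -sumr_const; apply: ler_sum => j.
  by rewrite !inE => /andP[_ /vab /andP[]].
apply: (@le_trans _ _ (#|r :\ i|%:R * b)); last by apply: ler_wpM2r => //; lra.
rewrite mulr_natl -sumr_const; apply: ler_sum => j.
by rewrite !inE => /andP[_ /vab /andP[]].
Qed.

Lemma prune_arith (R : realFieldType) (m a b s e : R) :
  1 < m -> 0 < a -> a <= b ->
  (m + 1) * b / ((m - 1) * a) <= 2 * e - 1 ->
  (m - 1) * a <= s <= m * b ->
  s <= e * ((m - 1) * ((b + a) / 2)) /\ (m - 1) * ((b + a) / 2) <= e * s.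
Proof.
move=> m1 a0 ab.
have ma0 : 0 < (m - 1) * a by rewrite mulr_gt0 // subr_gt0.
rewrite ler_pdivrMr // => crit /andP[las sub].
have e0 : 0 <= e.
  have : 0 <= (2 * e - 1) * ((m - 1) * a).
    by apply: le_trans crit; rewrite mulr_ge0; lra.
  by rewrite pmulr_lge0 //; lra.
have gap : 0 <= (b - a) * ((m + 1) * b - (m - 1) * a).
  rewrite mulr_ge0 ?subr_ge0 //.
  by apply: ler_pM; lra.
split.
  (* After scaling by [4 * a], the difference of the two sides is [gap] plus the slack of [crit]
     times [a + b]. *)
  apply: le_trans sub _; rewrite -(ler_pM2r (_ : 0 < 4 * a)); last by lra.
  have := ler_wpM2r (_ : 0 <= a + b) crit => /(_ ltac:(lra)).
  lra.
(* Since [(m - 1) * b <= (m + 1) * b], [crit] gives [(m - 1) * (b + a) <= 2 * e * (m - 1) * a]. *)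
apply: (@le_trans _ _ (e * ((m - 1) * a))); last by apply: ler_wpM2l.
lra.
Qed.

Lemma admissible_prune_bounds (R : realType) (n : nat)
    (v : 'I_n -> 'I_n -> R) (eps : R) (q r : {set 'I_n}) (s : R) (i : 'I_n) :
  admissible_prune v eps q r s -> i \in q ->
  contribution v r i <= expR eps * s /\ s <= expR eps * contribution v r i.
Proof.
move=> [a [b [vab r2 a0 crit ->]]] iq.
(* A point of [r], paired with [i], witnesses [a <= b]. *)
have [j jr] : exists j, j \in r by apply/card_gt0P; exact: leq_trans r2.
have ab : a <= b by have /andP[] := vab i j iq jr; exact: le_trans.
apply: prune_arith crit _ => //; first by rewrite ltr1n.
by apply: contribution_bounds => [k kr||]; [exact: vab| lra | lra].
Qed.

Lemma approx_sum_bounds (R : realType) (n : nat) (v : 'I_n -> 'I_n -> R)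
    (eps : R) (tq tr : bintree n) (ts : seq (terminal R n)) (i : 'I_n) :
  0 <= eps -> (forall j, 0 <= v i j) ->
  index_tree tq -> index_tree tr -> dual_tree_eval tq tr ts ->
  (forall (q r : {set 'I_n}) (s : R), (q, r, Some s) \in ts ->
    admissible_prune v eps q r s) ->
  loo_sum v i <= expR eps * approx_sum v ts i /\
  approx_sum v ts i <= expR eps * loo_sum v i.
Proof.
move=> eps0 v0 [pq Tq] [pr Tr] ev adm.
(* At the roots this writes [loo_sum v i] as a sum over the terminal pairs that index [approx_sum],
   so terms can be compared one by one. *)
have := dual_tree_eval_sum _ _ v i _ _ _ ev pq pr.
rewrite Tq Tr inE mulr1n contribution_setT => <-.
have term t : t \in ts -> i \in t.1.1 ->
    contribution v t.1.2 i <= expR eps * terminal_value v t i /\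
    terminal_value v t i <= expR eps * contribution v t.1.2 i.
  case: t => [[q r] [s|]] tts iq; rewrite /terminal_value /=.
    exact: admissible_prune_bounds (adm _ _ _ tts) iq.
  by split; rewrite ler_peMl ?contribution_ge0 // -expR0 ler_expR.
rewrite /approx_sum !mulr_sumr; split;
  rewrite big_seq_cond [leRHS]big_seq_cond;
  by apply: ler_sum => t /andP[tts iq]; have [] := term t tts iq.
Qed.

Lemma ln_dist_le (R : realType) (a b eps : R) :
  0 < a -> a <= expR eps * b -> b <= expR eps * a -> `|ln b - ln a| <= eps.
Proof.
move=> a0 ab ba.
(* Positivity of the approximation has to be derived: [ln] takes a default value on nonpositive
   reals. *)
have b0 : 0 < b by have := lt_le_trans a0 ab; rewrite pmulr_rgt0 ?expR_gt0.
have lnM c : 0 < c -> ln (expR eps * c) = eps + ln c.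
  by move=> c0; rewrite lnM ?posrE ?expR_gt0 // expRK.
have lab : ln a <= eps + ln b by rewrite -lnM // ler_ln ?posrE ?mulr_gt0 ?expR_gt0.
have lba : ln b <= eps + ln a by rewrite -lnM // ler_ln ?posrE ?mulr_gt0 ?expR_gt0.
by rewrite ler_norml; apply/andP; split; lra.
Qed.

Lemma cv_loglik_dist_le (R : realType) (n : nat) (A B : 'I_n -> R) (eps : R) :
  (0 < n)%N -> (forall i, `|ln (B i) - ln (A i)| <= eps) ->
  `|cv_loglik B - cv_loglik A| <= eps.
Proof.
move=> n0 AB; rewrite /cv_loglik opprB addrA subrK -mulrBr -sumrB normrM.
rewrite ger0_norm ?invr_ge0 // mulrC ler_pdivrMr ?ltr0n //.
apply: (le_trans (ler_norm_sum _ _ _)).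
by rewrite mulr_natr -[n in leRHS]card_ord -sumr_const; exact: ler_sum.
Qed.

Theorem theorem1 (R : realType) (n d : nat) (K : R -> R)
    (x : 'I_n -> 'rV[R]_d) (y : 'I_n -> R) (h1 h2 eps : R)
    (tq tr : bintree n) (ts : seq (terminal R n)) :
  (2 <= n)%N ->
  is_kernel K ->
  0 < h1 -> 0 < h2 -> 0 < eps ->
  let v := kernel_weight K h1 h2 x y in
  let A := loo_sum v in
  let Ahat := approx_sum v ts in
  (forall i, 0 < A i) ->
  index_tree tq -> index_tree tr ->
  dual_tree_eval tq tr ts ->
  (forall (q r : {set 'I_n}) (s : R), (q, r, Some s) \in ts ->
    admissible_prune v eps q r s) ->
  `|cv_loglik Ahat - cv_loglik A| <= eps.
Proof.
move=> n2 [K0 _ _ _] h10 h20 eps0 v A Ahat A0 Tq Tr ev adm.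
apply: cv_loglik_dist_le => [|i]; first exact: leq_trans n2.
have v0 j : 0 <= v i j by apply: kernel_weight_ge0 => //; exact: ltW.
have [lo hi] := approx_sum_bounds _ _ _ _ _ _ _ i (ltW eps0) v0 Tq Tr ev adm.
exact: ln_dist_le.
Qed.
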